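(* The incomplete gamma function $\gamma(a,t)$ satisfies, for $t\ge 0$, $$\gamma(a,t)=\frac{2}{\Gamma(b)}\int_0^{\pi/2}\gamma\!\left(a+b,\,t\sec^2(\theta)\right)\cos^{2a-1}(\theta)\,\sin^{2b-1}(\theta)\,d\theta.$$
   Context: The lower incomplete gamma function is defined as $\gamma(s,x)=\int_0^x u^{s-1}e^{-u}\,du$, and $\Gamma$ is the gamma function. *)

(* Defs.v *)
From HB Require Import structures.
From mathcomp Require Import all_boot all_order all_algebra.
From mathcomp Require Import all_classical all_reals all_analysis.
From mathcomp Require Import complex.

Set Implicit Arguments.
Unset Strict Implicit.
Unset Printing Implicit Defensive.
Import Order.TTheory GRing.Theory Num.Theory.
Import numFieldNormedType.Exports.
Local Open Scope classical_set_scope.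
Local Open Scope ring_scope.
Local Open Scope complex_scope.

Definition cexp (R : realType) (z : R[i]) : R[i] :=
  (expR (complex.Re z))%:C * (cos (complex.Im z) +i* sin (complex.Im z)).

(* Principal power of a positive real base; only ever used with 0 < u. *)
Definition cpow (R : realType) (u : R) (s : R[i]) : R[i] :=
  cexp (s * (ln u)%:C).

(* Lebesgue integral of a complex-valued function of a real variable. *)
Definition cintegral (R : realType) (D : set R) (f : R -> R[i]) : R[i] :=
  Rintegral (@lebesgue_measure R) D (fun x => complex.Re (f x)) +i*
  Rintegral (@lebesgue_measure R) D (fun x => complex.Im (f x)).

(* Endpoints are excluded from the domains of integration, here and in the
   integral over `]0, pi / 2[: they form a null set, and the integrands need
   not be defined there. *)
Definition lower_gamma (R : realType) (s : R[i]) (x : R) : R[i] :=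
  cintegral `]0, x[ (fun u => cpow u (s - 1) * (expR (- u))%:C).

(* Euler's integral, the definition of the gamma function for 0 < Re s. *)
Definition Gamma (R : realType) (s : R[i]) : R[i] :=
  cintegral `]0, +oo[ (fun u => cpow u (s - 1) * (expR (- u))%:C).

Definition sec (R : realType) (x : R) : R := (cos x)^-1.

(* Main.v *)
Require Import Defs.
From HB Require Import structures.
From mathcomp Require Import all_boot all_order all_algebra.
From mathcomp Require Import all_classical all_reals all_analysis.
From mathcomp Require Import complex measurable_realfun ring lra.

Set Implicit Arguments.
Unset Strict Implicit.
Unset Printing Implicit Defensive.
Import Order.TTheory GRing.Theory Num.Theory.
Import numFieldNormedType.Exports.
Local Open Scope classical_set_scope.
Local Open Scope ring_scope.
Local Open Scope complex_scope.

(** Write h_s(u) = u^(s-1) e^(-u) ([gamma_kernel]). The identity comes from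
    integrating the kernel
      K(w, theta) = h_a(w) h_b(w tan^2 theta) w tan theta / cos^2 theta
    ([gamma_beta_kernel]) over 0 < w < t and 0 < theta < pi/2 in both orders.

    For fixed w, the factor w tan theta / cos^2 theta is half the derivative of
    theta |-> w tan^2 theta, which maps ]0, pi/2[ increasingly onto ]0, +oo[;
    so the theta-integral is h_a(w) Gamma(b) / 2
    ([cintegral_gamma_beta_kernel_theta]), and integrating in w gives
    gamma(a, t) Gamma(b) / 2. For fixed theta, 1 + tan^2 = sec^2 merges the two
    exponentials into exp(- w sec^2 theta), and K becomes
    cos^(2a-1) theta sin^(2b-1) theta h_(a+b)(w sec^2 theta) sec^2 theta
    ([gamma_beta_kernelE]); the substitution u = w sec^2 theta turns the
    w-integral into the integrand of the right-hand side
    ([cintegral_gamma_beta_kernel_w]). The exchange of the integrals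
    ([gamma_beta_kernel_Fubini]) is legitimate because |h_s| = h_(Re s), so that
    |K| is the same kernel for the real exponents Re a and Re b, whose iterated
    integral is finite.

    It remains to divide by Gamma(b), which requires that Gamma have no zero on
    Re b > 0 ([Gamma_neq0]). Put t = Im b and
      J(p, phi) = int_0^oo u^(p-1) e^(-u) cos (t ln u + phi) du
    ([osc_gamma]). If Gamma(b) = 0 then J(Re b, phi) = 0 for all phi, and
    integration by parts ([osc_gammaS]) propagates this to J(Re b + n, phi) for
    all n. But a gamma-distributed variable of large parameter P is
    concentrated near P, so the oscillating factor with phi = - t ln P is close
    to 1 for most of the mass; concretely, cos x >= 1 - x^2/2 and
    (ln r)^2 <= 4 (r - 2 + 1/r) at r = u / P bound J(P, - t ln P) below by a
    combination of three values of the real gamma function, which is positive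
    as soon as P - 1 > 2 t^2 ([osc_gamma_gt0]). *)

(** * Change of variables on open intervals *)

Section change_of_variables.
Context {R : realType}.
Local Notation mu := (@lebesgue_measure R).

(** Integrals over an open interval, bounded or not, are computed as limits over
    an increasing sequence of compact subintervals, on which the integrands are
    continuous up to the endpoints. *)
Definition exhausts (a_ b_ : R^nat) (D : set R) :=
  [/\ nonincreasing_seq a_, nondecreasing_seq b_,
      forall n, a_ n <= b_ n & \bigcup_n `[a_ n, b_ n]%classic = D].

(** Exponential endpoints make [ln] take integer values there, which keeps the
    boundary terms of an integration by parts on ]0, +oo[ elementary. *)
Lemma exhausts_itv0y :
  exhausts (fun n => expR (- n%:R)) (fun n => expR n%:R) `]0, +oo[.
Proof.
split => [m n mn|m n mn|n|].
- by rewrite ler_expR lerN2 ler_nat.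
- by rewrite ler_expR ler_nat.
- by rewrite ler_expR (@le_trans _ _ 0)// oppr_le0.
apply/seteqP; split => [x [n _]|x] /=; rewrite !in_itv/= ?andbT.
  by move=> /andP[+ _]; apply: lt_le_trans; exact: expR_gt0.
move=> x0; exists (Num.truncn `|ln x|).+1 => //=; rewrite in_itv/=.
have := ltW (truncnS_gt `|ln x|); rewrite ler_norml => /andP[? ?].
by rewrite -{2 3}(lnK x0) !ler_expR; apply/andP; split.
Qed.

Lemma exhausts_itvoo (a b : R) : a < b ->
  exhausts (fun n => a + (b - a) / n.+2%:R) (fun n => b - (b - a) / n.+2%:R)
           `]a, b[.
Proof.
move=> ab; have ba0 : 0 < b - a by rewrite subr_gt0.
have dec m n : (m <= n)%N -> (b - a) / n.+2%:R <= (b - a) / m.+2%:R.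
  by move=> mn; rewrite ler_pM2l// lef_pV2 ?posrE// ler_nat.
split => [m n mn|m n mn|n|].
- by rewrite lerD2l dec.
- by rewrite lerD2l lerN2 dec.
- have : (b - a) / n.+2%:R <= (b - a) / 2 by exact: (dec 0%N).
  by move: (_ / n.+2%:R) => d; lra.
apply/seteqP; split => [x [n _]|x] /=; rewrite !in_itv/=.
  have : 0 < (b - a) / n.+2%:R by rewrite divr_gt0.
  by move: (_ / _) => d d0 /andP[? ?]; apply/andP; split; lra.
move=> /andP[ax xb].
set m := Num.min (x - a) (b - x).
have m0 : 0 < m by rewrite lt_min !subr_gt0 ax.
exists (Num.truncn ((b - a) / m)) => //=.
suff : (b - a) / (Num.truncn ((b - a) / m)).+2%:R <= m.
  rewrite /m le_min => /andP[]; move: (_ / _) => d; rewrite in_itv/= => ? ?.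
  by apply/andP; split; lra.
rewrite ler_pdivrMr// mulrC -ler_pdivrMr//.
rewrite (le_trans (ltW (truncnS_gt _)))// ler_nat//.
Qed.

Lemma exhausts_sub (a_ b_ : R^nat) (D : set R) n : exhausts a_ b_ D ->
  `[a_ n, b_ n]%classic `<=` D.
Proof. by case=> _ _ _ <- x abx; exists n. Qed.

Lemma exhausts_subset (a_ b_ : R^nat) (D : set R) : exhausts a_ b_ D ->
  {homo (fun n => [set` `[a_ n, b_ n]]) : n m / (n <= m)%N >-> (n <= m)%O}.
Proof.
move=> [na nb _ _] m n mn; apply/subsetPset => x /=; rewrite !in_itv/=.
by move=> /andP[? ?]; rewrite (le_trans (na _ _ mn))//= (le_trans _ (nb _ _ mn)).
Qed.

Lemma exhausts_measurable (a_ b_ : R^nat) (D : set R) : exhausts a_ b_ D ->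
  measurable D.
Proof. by case=> _ _ _ <-; apply: bigcupT_measurable => n. Qed.

Lemma exhausts_image (a_ b_ : R^nat) (D : set R) (F : R -> R) :
  exhausts a_ b_ D -> {in D &, {homo F : x y / x < y}} ->
  is_interval (F @` D) -> exhausts (F \o a_) (F \o b_) (F @` D).
Proof.
move=> ex incF itvF; have [na nb ab DE] := ex.
have Dab n x : a_ n <= x <= b_ n -> x \in D.
  by move=> abx; rewrite inE; apply: (exhausts_sub (n := n) ex); rewrite /= in_itv.
have leF : {in D &, {homo F : x y / x <= y}}.
  move=> x y Dx Dy; rewrite le_eqVlt => /predU1P[->//|xy].
  by rewrite ltW// incF.
have Da n : a_ n \in D by rewrite (Dab n)// lexx ab.
have Db n : b_ n \in D by rewrite (Dab n)// lexx ab.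
split => [m n mn|m n mn|n|] /=.
- by rewrite leF// na.
- by rewrite leF// nb.
- by rewrite leF.
apply/seteqP; split => [y [n _] /=|_ [x Dx <-]].
  rewrite in_itv/= => aby; apply: itvF aby.
    by exists (a_ n) => //; rewrite -inE.
  by exists (b_ n) => //; rewrite -inE.
move: (Dx); rewrite -{1}DE => -[n _ /=]; rewrite in_itv/= => abx.
have /andP[anx xbn] := abx; have Dx' : x \in D by rewrite inE.
by exists n => //=; rewrite in_itv/=; apply/andP; split; exact: leF.
Qed.

Lemma within_continuous_sub (A D : set R) (f : R -> R) : A `<=` D ->
  (forall x, D x -> {for x, continuous f}) -> {within A, continuous f}.
Proof.
move=> AD cf; apply: continuous_in_subspaceT => x; rewrite inE => Ax.
exact/cf/AD.
Qed.

Lemma exhausts_measurable_fun (a_ b_ : R^nat) (D : set R) (f : R -> R) :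
  exhausts a_ b_ D -> (forall x, D x -> {for x, continuous f}) ->
  measurable_fun D f.
Proof.
move=> ex cf; have mD := exhausts_measurable ex.
by apply: subspace_continuous_measurable_fun => //; exact: within_continuous_sub cf.
Qed.

Lemma ge0_cvg_integral_exhausts (a_ b_ : R^nat) (D : set R) (f : R -> \bar R) :
  exhausts a_ b_ D -> measurable_fun D f -> (forall x, D x -> (0 <= f x)%E) ->
  (\int[mu]_(x in `[a_ n, b_ n]) f x)%E @[n --> \oo] -->
  (\int[mu]_(x in D) f x)%E.
Proof.
move=> ex mf f0; have mD := exhausts_measurable ex.
have [_ _ _ DE] := ex; rewrite -[in X in _ --> X]DE.
apply: ge0_nondecreasing_set_cvg_integral => //.
- exact: exhausts_subset ex.
- by move=> n; apply: measurable_funS mf => //; exact: exhausts_sub ex.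
- by move=> n x abx; apply/f0/(exhausts_sub ex abx).
Qed.

(** On each segment of the exhaustion of [D] this is substitution for a C^1
    increasing function; increasing maps send the exhaustion of [D] to one of
    its image, and monotone convergence passes to the limit on both sides. *)
Lemma ge0_integral_change_of_variables (a_ b_ : R^nat) (D : set R)
    (F f G : R -> R) :
  exhausts a_ b_ D -> open D -> {in D &, {homo F : x y / x < y}} ->
  is_interval (F @` D) ->
  (forall x, D x -> is_derive x 1 F (f x)) ->
  (forall x, D x -> {for x, continuous f}) ->
  (forall x, D x -> 0 <= f x) ->
  (forall y, (F @` D) y -> {for y, continuous G}) ->
  (forall y, (F @` D) y -> 0 <= G y) ->
  (\int[mu]_(y in F @` D) (G y)%:E = \int[mu]_(x in D) (G (F x) * f x)%:E)%E.
Proof.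
move=> ex oD incF itvF dF cf f0 cG G0.
have ex' := exhausts_image ex incF itvF.
have cF x : D x -> {for x, continuous F}.
  by move=> Dx; apply/differentiable_continuous/derivable1_diffP; case: (dF _ Dx).
have cGFf x : D x -> {for x, continuous (fun x => G (F x) * f x)}.
  move=> Dx; apply: continuousM; last exact: cf.
  by apply: (@continuous_comp _ _ _ F G); [exact: cF|apply: cG; exists x].
have /cvg_lim <- // : (\int[mu]_(x in `[F (a_ n), F (b_ n)]) (G x)%:E)%E @[n --> \oo] -->
    (\int[mu]_(y in F @` D) (G y)%:E)%E.
  apply: (ge0_cvg_integral_exhausts ex').
    by apply/measurable_EFinP; exact: exhausts_measurable_fun ex' cG.
  by move=> y Dy; rewrite lee_fin G0.
have /cvg_lim <- // : (\int[mu]_(x in `[a_ n, b_ n]) (G (F x) * f x)%:E)%E @[n --> \oo] -->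
    (\int[mu]_(x in D) (G (F x) * f x)%:E)%E.
  apply: (ge0_cvg_integral_exhausts ex).
    by apply/measurable_EFinP; exact: exhausts_measurable_fun ex cGFf.
  by move=> x Dx; rewrite lee_fin mulr_ge0 ?f0// G0//; exists x.
apply: congr_lim; apply/funext => n /=.
have [_ _ ab _] := ex.
have aD x : x \in `[a_ n, b_ n] -> D x by move=> xab; exact: (exhausts_sub ex xab).
have F'f x : x \in `[a_ n, b_ n] -> F^`()%classic x = f x.
  by move=> /aD /dF => -[_ <-]; rewrite derive1E.
have cF' x : x \in `[a_ n, b_ n] -> {for x, continuous F^`()%classic}.
  move=> /aD Dx.
  have : \forall y \near x, f y = F^`()%classic y.
    move: (oD) => /(_ _ Dx); apply: filterS => y Dy.
    by have [_ <-] := dF _ Dy; rewrite derive1E.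
  move=> nfF; rewrite /prop_for /continuous_at.
  rewrite -(nbhs_singleton nfF).
  by apply: cvg_trans (cf _ Dx); exact: near_eq_cvg.
have aab : a_ n \in `[a_ n, b_ n] by rewrite in_itv/= lexx ab.
have bab : b_ n \in `[a_ n, b_ n] by rewrite in_itv/= lexx ab.
rewrite (@integration_by_substitution_increasing _ F).
- by apply: eq_integral => x; rewrite inE/= => xab; rewrite !fctE F'f.
- exact: ab.
- by move=> x y /aD Dx /aD Dy; apply: incF; rewrite inE.
- by move=> x /subset_itv_oo_cc; exact: cF'.
- by apply/cvg_ex; exists (F^`()%classic (a_ n)); apply: cvg_at_right_filter; exact: cF'.
- by apply/cvg_ex; exists (F^`()%classic (b_ n)); apply: cvg_at_left_filter; exact: cF'.
- split.
  + by move=> x /subset_itv_oo_cc/aD/dF[].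
  + by apply: cvg_at_right_filter; exact/cF/aD.
  + by apply: cvg_at_left_filter; exact/cF/aD.
- apply: within_continuous_sub cG; exact: exhausts_sub ex'.
Qed.

(** As [f] is nonnegative, multiplication by [f] commutes with taking positive
    and negative parts, so the nonnegative case applies to each part. *)
Lemma integral_change_of_variables (a_ b_ : R^nat) (D : set R)
    (F f G : R -> R) :
  exhausts a_ b_ D -> open D -> {in D &, {homo F : x y / x < y}} ->
  is_interval (F @` D) ->
  (forall x, D x -> is_derive x 1 F (f x)) ->
  (forall x, D x -> {for x, continuous f}) ->
  (forall x, D x -> 0 <= f x) ->
  (forall y, (F @` D) y -> {for y, continuous G}) ->
  (\int[mu]_(y in F @` D) (G y)%:E = \int[mu]_(x in D) (G (F x) * f x)%:E)%E.
Proof.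
move=> ex oD incF itvF dF cf f0 cG.
have pos (H : R -> R) : (forall y, (F @` D) y -> {for y, continuous H}) ->
    (\int[mu]_(y in F @` D) (maxe (H y)%:E 0) =
     \int[mu]_(x in D) (maxe (H (F x) * f x)%:E 0))%E.
  move=> cH.
  transitivity (\int[mu]_(y in F @` D) (Num.max (H y) 0)%:E)%E.
    by apply: eq_integral => y _; rewrite EFin_max.
  rewrite (@ge0_integral_change_of_variables a_ b_ D F f (fun y => Num.max (H y) 0))//.
  - apply: eq_integral => x; rewrite inE => Dx.
    by rewrite -EFin_max maxr_pMl ?mul0r//; exact: f0.
  - by move=> y Dy; apply: (@continuous_max R R H (cst 0)); [exact: cH|exact: cst_continuous].
  - by move=> y _; rewrite le_max lexx orbT.
rewrite integralE [RHS]integralE; congr (_ - _)%E.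
  by under eq_integral do rewrite funeposE; rewrite pos//;
     under [RHS]eq_integral do rewrite funeposE.
under eq_integral do rewrite funenegE -EFinN.
rewrite (pos (fun y => - G y)); last by move=> y Dy; apply: continuousN; exact: cG.
under [RHS]eq_integral do rewrite funenegE -EFinN.
by apply: eq_integral => x _ /=; rewrite mulNr.
Qed.

End change_of_variables.

(** * Complex-valued integrals *)

Section integrable_EFin.
Context {d : measure_display} {T : measurableType d} {R : realType}
  {mu : {measure set T -> \bar R}}.
Implicit Types (D : set T) (f g : T -> R).

Lemma integrable_EFinZl D (k : R) f : measurable D -> mu.-integrable D (EFin \o f) ->
  mu.-integrable D (EFin \o (fun x => k * f x)).
Proof.
move=> mD /(integrableZl mD k); apply: eq_integrable => // x _ /=; exact: EFinM.
Qed.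

Lemma integrable_EFinD D f g : measurable D -> mu.-integrable D (EFin \o f) ->
  mu.-integrable D (EFin \o g) ->
  mu.-integrable D (EFin \o (fun x => f x + g x)).
Proof.
move=> mD /(integrableD mD) h /h; apply: eq_integrable => // x _ /=; exact: EFinD.
Qed.

Lemma integrable_EFinB D f g : measurable D -> mu.-integrable D (EFin \o f) ->
  mu.-integrable D (EFin \o g) ->
  mu.-integrable D (EFin \o (fun x => f x - g x)).
Proof.
move=> mD /(integrableB mD) h /h; apply: eq_integrable => // x _ /=; exact: EFinB.
Qed.

End integrable_EFin.

Section complex_integral.
Context {R : realType}.
Local Notation mu := (@lebesgue_measure R).
Implicit Types (D : set R) (f g : R -> R[i]).

Lemma Re_mulc (x y : R[i]) :
  complex.Re (x * y) = complex.Re x * complex.Re y - complex.Im x * complex.Im y.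
Proof. by case: x; case: y. Qed.

Lemma Im_mulc (x y : R[i]) :
  complex.Im (x * y) = complex.Re x * complex.Im y + complex.Im x * complex.Re y.
Proof. by case: x; case: y. Qed.

Lemma eq_Re_Im (x y : R[i]) : complex.Re x = complex.Re y ->
  complex.Im x = complex.Im y -> x = y.
Proof. by case: x => a b; case: y => c d /= -> ->. Qed.

Definition cintegrable D f :=
  mu.-integrable D (EFin \o (fun x => complex.Re (f x))) /\
  mu.-integrable D (EFin \o (fun x => complex.Im (f x))).

Lemma eq_cintegral D f g : (forall x, D x -> f x = g x) ->
  cintegral D f = cintegral D g.
Proof.
by move=> fg; congr (_ +i* _); apply: eq_Rintegral => x; rewrite inE => Dx; rewrite fg.
Qed.

Lemma cintegralZl D f (c : R[i]) : measurable D -> cintegrable D f ->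
  cintegral D (fun x => c * f x) = c * cintegral D f.
Proof.
move=> mD [rf jf].
apply: eq_Re_Im; rewrite ?Re_mulc ?Im_mulc /=.
- under eq_Rintegral do rewrite Re_mulc.
  by rewrite RintegralB ?RintegralZl//; exact: integrable_EFinZl.
- under eq_Rintegral do rewrite Im_mulc.
  by rewrite RintegralD ?RintegralZl//; exact: integrable_EFinZl.
Qed.

Lemma cintegralZr D f (c : R[i]) : measurable D -> cintegrable D f ->
  cintegral D (fun x => f x * c) = cintegral D f * c.
Proof.
move=> mD cf; rewrite mulrC -cintegralZl//; apply: eq_cintegral => x _.
exact: mulrC.
Qed.

Lemma cintegral_change_of_variables (a_ b_ : R^nat) D (F f : R -> R) (G : R -> R[i]) :
  exhausts a_ b_ D -> open D -> {in D &, {homo F : x y / x < y}} ->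
  is_interval (F @` D) ->
  (forall x, D x -> is_derive x 1 F (f x)) ->
  (forall x, D x -> {for x, continuous f}) ->
  (forall x, D x -> 0 <= f x) ->
  (forall y, (F @` D) y -> {for y, continuous (fun y => complex.Re (G y))}) ->
  (forall y, (F @` D) y -> {for y, continuous (fun y => complex.Im (G y))}) ->
  cintegral (F @` D) G = cintegral D (fun x => G (F x) * (f x)%:C).
Proof.
move=> ex oD incF itvF dF cf f0 crG ciG; rewrite /cintegral /Rintegral.
rewrite (integral_change_of_variables ex oD incF itvF dF cf f0 crG).
rewrite (integral_change_of_variables ex oD incF itvF dF cf f0 ciG).
by congr (fine _ +i* fine _); apply: eq_integral => x _;
  rewrite ?Re_mulc ?Im_mulc /= mulr0 ?subr0 ?add0r.
Qed.

End complex_integral.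

Section fubini.
Context {d1 d2 : measure_display} {T1 : measurableType d1} {T2 : measurableType d2}
  {R : realType} {m1 : {sigma_finite_measure set T1 -> \bar R}}
  {m2 : {sigma_finite_measure set T2 -> \bar R}}.

(** The inner integrals are finite only almost everywhere, and [Rintegral] sends
    an infinite value to 0; the exceptional set being negligible, the outer
    integrals do not see the difference. *)
Lemma Rintegral_Fubini (A : set T1) (B : set T2) (f : T1 * T2 -> R) :
  measurable A -> measurable B -> measurable_fun (A `*` B) f ->
  (\int[m1]_(x in A) \int[m2]_(y in B) `|f (x, y)|%:E < +oo)%E ->
  Rintegral m1 A (fun x => Rintegral m2 B (fun y => f (x, y))) =
  Rintegral m2 B (fun y => Rintegral m1 A (fun x => f (x, y))).
Proof.
move=> mA mB mf foo.
pose h := EFin \o (f \_ (A `*` B)).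
have mh : measurable_fun setT h.
  apply/measurable_EFinP/(measurable_restrictT _ _).1 => //; exact: measurableX.
have hE1 x : (\int[m2]_y `|h (x, y)|)%E =
    ((fun x => (\int[m2]_(y in B) `|f (x, y)|%:E)%E) \_ A) x.
  rewrite patchE; case: ifPn => [|] xA.
    rewrite [RHS]integral_mkcond; apply: eq_integral => y _.
    rewrite /h /= !patchE in_setX/= xA/=.
    by case: ifPn => // _; rewrite normr0.
  apply: integral0_eq => y _; rewrite /h /= patchE in_setX/= (negbTE xA)/=.
  by rewrite normr0.
have hE x : (\int[m2]_y h (x, y))%E =
    ((fun x => (\int[m2]_(y in B) (f (x, y))%:E)%E) \_ A) x.
  rewrite patchE; case: ifPn => [|] xA.
    rewrite [RHS]integral_mkcond; apply: eq_integral => y _.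
    rewrite /h /= !patchE in_setX/= xA/=.
    by case: ifPn.
  by apply: integral0_eq => y _; rewrite /h /= patchE in_setX/= (negbTE xA)/=.
have hE' y : (\int[m1]_x h (x, y))%E =
    ((fun y => (\int[m1]_(x in A) (f (x, y))%:E)%E) \_ B) y.
  rewrite patchE; case: ifPn => [|] yB.
    rewrite [RHS]integral_mkcond; apply: eq_integral => x _.
    rewrite /h /= !patchE in_setX/= yB/= andbT.
    by case: ifPn.
  by apply: integral0_eq => x _; rewrite /h /= patchE in_setX/= (negbTE yB)/= andbF.
have ih : (m1 \x m2)%E.-integrable setT h.
  apply/(integrable12ltyP m1 m2 mh).
  by under eq_integral do rewrite hE1; rewrite -integral_mkcond.
have E1 : Rintegral m1 A (fun x => Rintegral m2 B (fun y => f (x, y))) =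
          fine (\int[m1]_x \int[m2]_y h (x, y))%E.
  rewrite Rintegral_mkcond /Rintegral; congr fine.
  have mF := measurable_fubini_F ih.
  have FE x : ((fun x => Rintegral m2 B (fun y => f (x, y))) \_ A) x =
      fine (\int[m2]_y h (x, y))%E.
    by rewrite hE !patchE; case: ifPn.
  under eq_integral do rewrite FE.
  apply: ae_eq_integral => //.
    by apply/measurable_EFinP; apply: measurableT_comp mF.
  apply: filterS (ae_integrable1 ih) => x ihx _ /=.
  by rewrite fineK//; apply: integrable_fin_num.
have E2 : Rintegral m2 B (fun y => Rintegral m1 A (fun x => f (x, y))) =
          fine (\int[m2]_y \int[m1]_x h (x, y))%E.
  rewrite Rintegral_mkcond /Rintegral; congr fine.
  have mG := measurable_fubini_G ih.
  have GE y : ((fun y => Rintegral m1 A (fun x => f (x, y))) \_ B) y =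
      fine (\int[m1]_x h (x, y))%E.
    by rewrite hE' !patchE; case: ifPn.
  under eq_integral do rewrite GE.
  apply: ae_eq_integral => //.
    by apply/measurable_EFinP; apply: measurableT_comp mG.
  apply: filterS (ae_integrable2 ih) => y ihy _ /=.
  by rewrite fineK//; apply: integrable_fin_num.
by rewrite E1 E2 Fubini.
Qed.
End fubini.

Section monotonicity.
Local Open Scope ereal_scope.

(** The integral of a nonnegative function is the supremum of the integrals of
    the simple functions below it, so it is monotone on all nonnegative
    functions; in an iterated integral this compares the inner integrals
    as mere functions of the remaining variable. *)
Lemma ge0_le_integral_sup d (T : measurableType d) (R : realType)
    (mu : {measure set T -> \bar R}) (D : set T) (f g : T -> \bar R) :
  (forall x, D x -> 0 <= f x) -> (forall x, D x -> f x <= g x) ->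
  \int[mu]_(x in D) f x <= \int[mu]_(x in D) g x.
Proof.
move=> f0 fg; have g0 x : D x -> 0 <= g x.
  by move=> Dx; apply: le_trans (f0 _ Dx) (fg _ Dx).
rewrite !ge0_integralE//; apply: ereal_sup_le => _ [h hf <-]; exists h => // x.
apply: le_trans (hf x) _; rewrite !patchE; case: ifPn => //.
by rewrite inE => /fg.
Qed.

End monotonicity.

Section complex_fubini.
Context {R : realType}.
Local Notation mu := (@lebesgue_measure R).

Lemma cintegral_Fubini (A B : set R) (F : R -> R -> R[i]) (g : R -> R -> R) :
  measurable A -> measurable B ->
  measurable_fun (A `*` B) (fun z => complex.Re (F z.1 z.2)) ->
  measurable_fun (A `*` B) (fun z => complex.Im (F z.1 z.2)) ->
  (forall x y, A x -> B y -> `|complex.Re (F x y)| <= g x y) ->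
  (forall x y, A x -> B y -> `|complex.Im (F x y)| <= g x y) ->
  (\int[mu]_(x in A) \int[mu]_(y in B) (g x y)%:E < +oo)%E ->
  cintegral A (fun x => cintegral B (F x)) =
  cintegral B (fun y => cintegral A (F ^~ y)).
Proof.
move=> mA mB mre mim gre gim goo.
have bound (f : R -> R -> R) : (forall x y, A x -> B y -> `|f x y| <= g x y) ->
    (\int[mu]_(x in A) \int[mu]_(y in B) `|f x y|%:E < +oo)%E.
  move=> fg; apply: le_lt_trans goo.
  apply: ge0_le_integral_sup => x Ax; first by apply: integral_ge0 => y _.
  by apply: ge0_le_integral_sup => y By; rewrite lee_fin ?fg.
have eRe := Rintegral_Fubini (m1 := mu) (m2 := mu) mA mB mre
  (bound (fun x y => complex.Re (F x y)) gre).
have eIm := Rintegral_Fubini (m1 := mu) (m2 := mu) mA mB mim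
  (bound (fun x y => complex.Im (F x y)) gim).
by congr (_ +i* _); [exact: eRe|exact: eIm].
Qed.

End complex_fubini.

(** * The fundamental theorem of calculus on open intervals *)

Section ftc.
Local Open Scope ereal_scope.
Context {R : realType}.
Local Notation mu := (@lebesgue_measure R).

Lemma cvg_integral_exhausts (a_ b_ : R^nat) (D : set R) (f : R -> \bar R) :
  exhausts a_ b_ D -> mu.-integrable D f ->
  \int[mu]_(x in `[a_ n, b_ n]) f x @[n --> \oo] --> \int[mu]_(x in D) f x.
Proof.
move=> ex iF; have mf := measurable_int _ iF.
have mD := exhausts_measurable ex.
rewrite integralE; under eq_cvg do rewrite integralE.
apply: cvgeB.
- by apply: fin_num_adde_defr; apply: integrable_pos_fin_num.
- apply: ge0_cvg_integral_exhausts => //; exact: measurable_funepos.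
- apply: ge0_cvg_integral_exhausts => //; exact: measurable_funeneg.
Qed.

Lemma integral_exhausts_FTC (a_ b_ : R^nat) (D : set R) (F f : R -> R) n :
  exhausts a_ b_ D ->
  (forall x, D x -> is_derive x 1%R F (f x)) ->
  (forall x, D x -> {for x, continuous f}) ->
  \int[mu]_(x in `[a_ n, b_ n]) (f x)%:E = (F (b_ n) - F (a_ n))%:E.
Proof.
move=> ex dF cf; have [_ _ ab _] := ex.
have [->|anbn] := eqVneq (a_ n) (b_ n).
  by rewrite set_itv1 integral_set1 subrr.
have {}anbn : (a_ n < b_ n)%R by rewrite lt_neqAle anbn ab.
have aD x : x \in `[a_ n, b_ n]%R -> D x by move=> xab; exact: (exhausts_sub ex xab).
have cF x : D x -> {for x, continuous F}.
  by move=> Dx; apply/differentiable_continuous/derivable1_diffP; case: (dF _ Dx).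
rewrite EFinB; apply: continuous_FTC2 => //.
- by apply: within_continuous_sub cf; exact: exhausts_sub ex.
- split.
  + by move=> x /subset_itv_oo_cc/aD/dF[].
  + by apply: cvg_at_right_filter; apply/cF/aD; rewrite in_itv/= lexx ltW.
  + by apply: cvg_at_left_filter; apply/cF/aD; rewrite in_itv/= lexx ltW.
- by move=> x /subset_itv_oo_cc/aD/dF[_ <-]; rewrite derive1E.
Qed.

(** The integrals over the segments of the exhaustion are increments of the
    primitive, so a bound on the increments bounds the integral. *)
Lemma ge0_integrable_bounded_primitive (a_ b_ : R^nat) (D : set R) (F f : R -> R) (M : R) :
  exhausts a_ b_ D ->
  (forall x, D x -> is_derive x 1%R F (f x)) ->
  (forall x, D x -> {for x, continuous f}) ->
  (forall x, D x -> 0 <= f x)%R ->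
  (forall x y, D x -> D y -> F y - F x <= M)%R ->
  mu.-integrable D (EFin \o f).
Proof.
move=> ex dF cf f0 FM; have mf := exhausts_measurable_fun ex cf.
apply/integrableP; split; first exact/measurable_EFinP.
rewrite (@le_lt_trans _ _ M%:E) ?ltry//.
have -> : \int[mu]_(x in D) `|(EFin \o f) x| = \int[mu]_(x in D) (f x)%:E.
  by apply: eq_integral => x; rewrite inE => Dx; rewrite /= ger0_norm// f0.
have cvf : \int[mu]_(x in `[a_ n, b_ n]) (f x)%:E @[n --> \oo] -->
    \int[mu]_(x in D) (f x)%:E.
  by apply: (ge0_cvg_integral_exhausts ex) => //; exact/measurable_EFinP.
rewrite -(cvg_lim _ cvf)//; apply: lime_le; first by apply/cvg_ex; eexists; exact: cvf.
apply: nearW => n; rewrite (integral_exhausts_FTC n ex dF cf) lee_fin.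
have [_ _ ab _] := ex.
by apply: FM; apply: (exhausts_sub (n := n) ex); rewrite /= in_itv/= lexx ab.
Qed.

Lemma Rintegral_FTC (a_ b_ : R^nat) (D : set R) (F f : R -> R) (l : R) :
  exhausts a_ b_ D ->
  (forall x, D x -> is_derive x 1%R F (f x)) ->
  (forall x, D x -> {for x, continuous f}) ->
  mu.-integrable D (EFin \o f) ->
  (F (b_ n) - F (a_ n))%R @[n --> \oo] --> l ->
  Rintegral mu D f = l.
Proof.
move=> ex dF cf iF Fl; have := cvg_integral_exhausts ex iF.
under eq_cvg do rewrite /= (integral_exhausts_FTC _ ex dF cf).
move=> /cvg_lim intE; rewrite /Rintegral -[X in fine X]intE//.
have /cvg_lim -> // : (F (b_ n) - F (a_ n))%:E @[n --> \oo] --> l%:E.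
by apply: cvg_EFin => //; exact: nearW.
Qed.

End ftc.

(** * The gamma density and its oscillating integrals *)

Section gamma_density.
Context {R : realType}.
Local Notation mu := (@lebesgue_measure R).
Implicit Types (p t u phi : R).

(** This is u^(p-1) e^(-u) for [0 < u]. With a single exponential, positivity is
    immediate and products of powers become sums of exponents. *)
Definition gamma_dens p u : R := expR ((p - 1) * ln u - u).

(** The phase [phi] treats the real part ([phi = 0]) and the imaginary part
    ([phi = - pi / 2]) of Gamma (p + i t) at once, and multiplying Gamma by a
    complex number of modulus 1 amounts to shifting it. *)
Definition osc_gamma t p phi : R :=
  Rintegral mu `]0, +oo[ (fun u => gamma_dens p u * cos (t * ln u + phi)).

Lemma itv0yP u : `]0, +oo[%classic u -> 0 < u.
Proof. by rewrite /= in_itv/= andbT. Qed.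

Lemma gamma_dens_gt0 p u : 0 < gamma_dens p u.
Proof. exact: expR_gt0. Qed.

Lemma gamma_densS p u : 0 < u -> gamma_dens (p + 1) u = gamma_dens p u * u.
Proof.
move=> u0; rewrite -[in X in _ * X](lnK u0) /gamma_dens -expRD.
by congr expR; ring.
Qed.

Lemma is_derive_phase t phi u : 0 < u ->
  is_derive u 1 (fun u => t * ln u + phi) (t / u).
Proof.
move=> u0; have dln := is_derive1_ln u0.
have -> : (fun u => t * ln u + phi) = cst t * @ln R + cst phi by [].
apply: is_derive_eq.
by rewrite scaler0 !addr0.
Qed.

Lemma continuous_phase t phi u : 0 < u ->
  {for u, continuous (fun u => t * ln u + phi)}.
Proof.
by move=> u0; apply/differentiable_continuous/derivable1_diffP;
  case: (is_derive_phase t phi u0).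
Qed.

Lemma is_derive_gamma_dens p u : 0 < u ->
  is_derive u 1 (gamma_dens p) (gamma_dens p u * ((p - 1) / u - 1)).
Proof.
move=> u0; have d1 := is_derive_phase (p - 1) 0 u0.
have d2 : is_derive u 1 (fun u => (p - 1) * ln u - u) ((p - 1) / u - 1).
  have -> : (fun u => (p - 1) * ln u - u) =
            (fun u => (p - 1) * ln u + 0) - (@idfun R).
    by apply/funext => x; rewrite !fctE addr0.
  exact: is_deriveB.
exact: (is_derive1_comp (is_derive_expR _) d2).
Qed.

Lemma continuous_gamma_dens p u : 0 < u -> {for u, continuous (gamma_dens p)}.
Proof.
by move=> u0; apply/differentiable_continuous/derivable1_diffP;
  case: (is_derive_gamma_dens p u0).
Qed.

Lemma is_derive_gamma_dens_cos p t phi u : 0 < u ->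
  is_derive u 1 (fun u => gamma_dens (p + 1) u * cos (t * ln u + phi))
    (gamma_dens p u * (p * cos (t * ln u + phi) - t * sin (t * ln u + phi))
     - gamma_dens (p + 1) u * cos (t * ln u + phi)).
Proof.
move=> u0; have d1 := is_derive_gamma_dens (p + 1) u0.
have d2 := is_derive1_comp (is_derive_cos _) (is_derive_phase t phi u0).
have -> : (fun u => gamma_dens (p + 1) u * cos (t * ln u + phi)) =
  gamma_dens (p + 1) * (cos \o (fun u => t * ln u + phi)) by [].
apply: is_derive_eq.
rewrite /= /GRing.scale/= gamma_densS//; field; lra.
Qed.

Lemma continuous_cos_phase t phi u : 0 < u ->
  {for u, continuous (fun u => cos (t * ln u + phi))}.
Proof.
move=> u0; apply: (@continuous_comp _ _ _ (fun u => t * ln u + phi)).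
  exact: continuous_phase.
exact: continuous_cos.
Qed.

Lemma continuous_gamma_dens_cos p t phi u : 0 < u ->
  {for u, continuous (fun u => gamma_dens p u * cos (t * ln u + phi))}.
Proof.
move=> u0; apply: continuousM; first exact: continuous_gamma_dens.
exact: continuous_cos_phase.
Qed.

(** The left-hand side is maximal at [u = p]: this is ln x <= x - 1 at
    x = u / p. *)
Lemma mulr_ln_le p u : 0 < p -> 0 < u -> p * ln u - u <= p * ln p.
Proof.
move=> p0 u0; have up0 : 0 < u / p by rewrite divr_gt0.
have : ln (1 + (u / p - 1)) <= u / p - 1 by apply: le_ln1Dx; lra.
rewrite addrC subrK ln_div ?posrE// => h.
have : p * (ln u - ln p) <= p * (u / p - 1) by rewrite ler_pM2l.
rewrite !mulrBr mulrCA divff ?gt_eqF// !mulr1; lra.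
Qed.

(** One dominating function serves both ends of ]0, +oo[: u^(p-1) / (1 + u^p)^2
    has the bounded primitive - 1 / (p (1 + u^p)), and (1 + u^p)^2 e^(-u) is
    bounded because 2 p ln u - u is. *)
Lemma integrable_gamma_dens p : 0 < p ->
  mu.-integrable `]0, +oo[ (EFin \o gamma_dens p).
Proof.
move=> p0.
(* [q u] is u^p; the term + 0 puts the exponent in the form t * ln u + phi. *)
pose q u := expR (p * ln u + 0).
pose g u := expR ((p - 1) * ln u + 0) * ((1 + q u) ^+ 2)^-1.
pose P u := - p^-1 * (1 + q u)^-1.
have q0 u : 0 < q u by exact: expR_gt0.
have q1 u : 0 < 1 + q u by rewrite addr_gt0.
have dq u : 0 < u -> is_derive u 1 q (q u * (p / u)).
  by move=> u0; exact: (is_derive1_comp (is_derive_expR _) (is_derive_phase p 0 u0)).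
have qE u : 0 < u -> q u = expR ((p - 1) * ln u + 0) * u.
  move=> u0; rewrite -[in X in _ * X](lnK u0) -expRD; congr expR; ring.
have d1 u : 0 < u -> is_derive u 1 (fun u => 1 + q u) (q u * (p / u)).
  move=> u0; have -> : (fun u => 1 + q u) = cst 1 + q by [].
  by have d := dq _ u0; apply: is_derive_eq; rewrite add0r.
have dP u : 0 < u -> is_derive u 1 P (g u).
  move=> u0.
  have d2 := @is_deriveV _ (fun u => 1 + q u) u _ _ (lt0r_neq0 (q1 u)) (d1 u u0).
  have -> : P = cst (- p^-1) * (fun u => (1 + q u)^-1) by [].
  apply: is_derive_eq.
  rewrite /= scaler0 addr0 /GRing.scale/= /g qE//.
  have := lt0r_neq0 (q1 u); rewrite qE// => ?; field.
  by apply/and3P; split => //; lra.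
have cg u : 0 < u -> {for u, continuous g}.
  move=> u0; apply: continuousM.
    apply: (@continuous_comp _ _ _ (fun u => (p - 1) * ln u + 0)).
      exact: continuous_phase.
    exact: continuous_expR.
  apply: continuousV; first by rewrite sqrf_eq0 gt_eqF.
  have c1 : {for u, continuous (fun u => 1 + q u)}.
    by apply/differentiable_continuous/derivable1_diffP; case: (d1 _ u0).
  exact: continuousM.
have iG : mu.-integrable `]0, +oo[ (EFin \o g).
  apply: (@ge0_integrable_bounded_primitive _ _ _ _ P g p^-1 exhausts_itv0y).
  - by move=> u /itv0yP; exact: dP.
  - by move=> u /itv0yP; exact: cg.
  - by move=> u _; rewrite mulr_ge0 ?expR_ge0// invr_ge0 sqr_ge0.
  - move=> x y _ _; rewrite /P.
    have bnd z : 0 <= (1 + q z)^-1 <= 1.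
      rewrite invr_ge0 ltW//= invf_le1//; have := q0 z; lra.
    have /andP[? ?] := bnd x; have /andP[? ?] := bnd y.
    have pp : 0 < p^-1 by rewrite invr_gt0.
    nra.
(* (1 + q)^2 <= 2 + 2 q^2, and e^(-u) <= 1 while q^2 e^(-u) is at most the
   maximum of exp (2 p ln u - u). *)
pose C := 2 + 2 * expR ((2 * p) * ln (2 * p)).
have iCg : mu.-integrable `]0, +oo[ (fun u => C%:E * (EFin \o g) u)%E.
  exact: integrableZl.
apply: le_integrable iCg => //.
  apply/measurable_EFinP; apply: (exhausts_measurable_fun exhausts_itv0y).
  by move=> u /itv0yP; exact: continuous_gamma_dens.
move=> u; rewrite /= in_itv/= andbT => u0; rewrite lee_fin.
have C0 : 0 <= C by rewrite addr_ge0// mulr_ge0// expR_ge0.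
have g0 : 0 <= g u by rewrite mulr_ge0 ?expR_ge0// invr_ge0 sqr_ge0.
rewrite (gtr0_norm (gamma_dens_gt0 p u)) (ger0_norm (mulr_ge0 C0 g0)).
rewrite /g mulrCA /gamma_dens expRD addr0 ler_pM2l ?expR_gt0//.
rewrite ler_pdivlMr ?exprn_gt0//.
have e1 : expR (- u) <= 1 by rewrite -expR0 ler_expR oppr_le0 ltW.
have e2 : q u ^+ 2 * expR (- u) <= expR ((2 * p) * ln (2 * p)).
  rewrite expr2 /q -!expRD ler_expR.
  have := @mulr_ln_le (2 * p) u ltac:(lra) u0; lra.
have := expR_gt0 (- u).
move: e1 e2; rewrite /C; have := sqr_ge0 (q u - 1).
move: (expR (- u)) (q u) (expR (_ * ln _)) => e x k; nra.
Qed.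

End gamma_density.

Section oscillating_gamma.
Context {R : realType}.
Local Notation mu := (@lebesgue_measure R).
Implicit Types (p t u phi : R).

Lemma integrable_gamma_dens_cos p t phi : 0 < p ->
  mu.-integrable `]0, +oo[
    (EFin \o (fun u => gamma_dens p u * cos (t * ln u + phi))).
Proof.
move=> p0; apply: le_integrable (integrable_gamma_dens p0) => //.
  apply/measurable_EFinP; apply: (exhausts_measurable_fun exhausts_itv0y).
  by move=> u /itv0yP; exact: continuous_gamma_dens_cos.
move=> u _; rewrite /= lee_fin normrM ler_piMr//; exact: cos_max.
Qed.

Lemma cvg_gamma_dens0 p : 0 < p ->
  gamma_dens (p + 1) (expR (- n%:R)) @[n --> \oo] --> (0 : R).
Proof.
move=> p0; apply: (@squeeze_cvgr _ _ _ _ (cst 0) (fun n => expR (- p) ^+ n)).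
- apply: nearW => n; rewrite expR_ge0/= /gamma_dens expRK -expRM_natr ler_expR.
  have := expR_gt0 (- n%:R : R); lra.
- exact: cvg_cst.
- by apply: cvg_expr; rewrite ger0_norm ?expR_ge0// -expR0 ltr_expR oppr_lt0.
Qed.

(** By [mulr_ln_le] at p + 1, exp (p ln u - u) is at most a constant times 1 / u,
    and 1 / u is e^(-n) along the exhaustion. *)
Lemma cvg_gamma_densy p : 0 < p ->
  gamma_dens (p + 1) (expR n%:R) @[n --> \oo] --> (0 : R).
Proof.
move=> p0; have p1 : 0 < p + 1 by rewrite addr_gt0.
pose k := expR ((p + 1) * ln (p + 1)).
apply: (@squeeze_cvgr _ _ _ _ (cst 0) (fun n => k * expR (- n%:R))).
- apply: nearW => n; rewrite expR_ge0/= /gamma_dens expRK -expRD ler_expR.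
  have := mulr_ln_le p1 (expR_gt0 n%:R); rewrite expRK; lra.
- exact: cvg_cst.
- by rewrite -[X in _ --> X](mulr0 k); apply: cvgMr; exact: cvgn_expR.
Qed.

(** The functional equation Gamma (s + 1) = s Gamma s in real form: integrate the
    derivative of u^p e^(-u) cos (t ln u + phi), which vanishes at both ends, and
    read - sin x as cos (x + pi / 2). *)
Lemma osc_gammaS p t phi : 0 < p ->
  osc_gamma t (p + 1) phi =
  p * osc_gamma t p phi + t * osc_gamma t p (phi + pi / 2).
Proof.
move=> p0; have p1 : 0 < p + 1 by rewrite addr_gt0.
have i0 := integrable_gamma_dens_cos t phi p0.
have i1 := integrable_gamma_dens_cos t (phi + pi / 2) p0.
have i2 := integrable_gamma_dens_cos t phi p1.
have i3 : mu.-integrable `]0, +oo[ (EFin \o (fun u =>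
    p * (gamma_dens p u * cos (t * ln u + phi)) +
    t * (gamma_dens p u * cos (t * ln u + (phi + pi / 2))))).
  by apply: integrable_EFinD => //; exact: integrable_EFinZl.
apply/esym/eqP; rewrite -subr_eq0; apply/eqP.
rewrite /osc_gamma -!RintegralZl// -RintegralD//; [|exact: integrable_EFinZl..].
rewrite -RintegralB//.
apply: (@Rintegral_FTC R _ _ _ (fun u => gamma_dens (p + 1) u * cos (t * ln u + phi))
  (fun u => p * (gamma_dens p u * cos (t * ln u + phi)) +
    t * (gamma_dens p u * cos (t * ln u + (phi + pi / 2))) -
    gamma_dens (p + 1) u * cos (t * ln u + phi)) 0 exhausts_itv0y).
- move=> u /itv0yP u0; apply: is_derive_eq (is_derive_gamma_dens_cos _ _ _ u0) _.
  by rewrite addrA cosDpihalf; ring.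
- move=> u /itv0yP u0.
  have c1 := @continuous_gamma_dens_cos _ p t phi _ u0.
  have c2 := @continuous_gamma_dens_cos _ p t (phi + pi / 2) _ u0.
  have c3 := @continuous_gamma_dens_cos _ (p + 1) t phi _ u0.
  by apply: cvgB c3; apply: cvgD; apply: cvgMr.
- exact: integrable_EFinB.
rewrite -[X in _ --> X](subr0 0).
have sq (v : R^nat) (d : R^nat) : d @ \oo --> 0 -> (forall n, 0 <= d n) ->
    (d n * cos (v n)) @[n --> \oo] --> (0 : R).
  move=> d0 dge0; apply: (@squeeze_cvgr _ _ _ _ (fun n => - d n) d) => //.
    apply: nearW => n; have := cos_le1 (v n); have := cos_geN1 (v n).
    by have := dge0 n; nra.
  by rewrite -[X in _ --> X]oppr0; exact: cvgN.
apply: cvgB; apply: sq => [|n]; rewrite ?expR_ge0//.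
  exact: cvg_gamma_densy.
exact: cvg_gamma_dens0.
Qed.

Lemma osc_gamma0_gt0 p : 0 < p -> 0 < osc_gamma 0 p 0.
Proof.
move=> p0.
have -> : osc_gamma 0 p 0 = Rintegral mu `]0, +oo[ (gamma_dens p).
  by apply: eq_Rintegral => u _; rewrite mul0r addr0 cos0 mulr1.
have i0 := integrable_gamma_dens p0.
(* A lower bound of the density on ]1, 2[, where |(p - 1) ln u| <= |p - 1| ln 2. *)
pose m := expR (- (`|p - 1| * ln 2) - 2).
have mm : (m%:E <= \int[mu]_(u in `]0%R, +oo[) (gamma_dens p u)%:E)%E.
  apply: (@le_trans _ _ (\int[mu]_(u in `]1%R, 2%R[) (gamma_dens p u)%:E)%E); last first.
    apply: ge0_subset_integral => //.
    - by case/integrableP : i0.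
    - by move=> u _; rewrite lee_fin expR_ge0.
    - by move=> u /=; rewrite !in_itv/= andbT => /andP[+ _]; apply: lt_trans.
  apply: (@le_trans _ _ (\int[mu]_(u in `]1%R, 2%R[) m%:E)%E).
    rewrite integral_cst//= lebesgue_measure_itv/= lte_fin ltr1n/=.
    by rewrite -EFinB (_ : 2 - 1 = 1 :> R) ?mule1//; lra.
  apply: ge0_le_integral_sup => u /=; rewrite in_itv/= => /andP[u1 u2].
    by rewrite lee_fin expR_ge0.
  rewrite lee_fin ler_expR; apply: lerB; last exact: ltW.
  rewrite lerNl -mulNr (le_trans (ler_norm _))// normrM normrN ler_wpM2l//.
  have lu : 0 <= ln u by rewrite ln_ge0// ltW.
  rewrite ger0_norm// ler_ln ?posrE//; [exact: ltW|lra].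
have fi : (\int[mu]_(u in `]0%R, +oo[) (gamma_dens p u)%:E)%E \is a fin_num.
  exact: integrable_fin_num i0.
rewrite /Rintegral -lte_fin fineK//; apply: lt_le_trans mm.
by rewrite lte_fin expR_gt0.
Qed.

Lemma cos_ge_1Bsqr (x : R) : 1 - x ^+ 2 / 2 <= cos x.
Proof.
wlog x0 : x / 0 <= x => [wlg|].
  have [|/ltW x0] := leP 0 x; first exact: wlg.
  by rewrite -(sqrrN x) -cosN; apply: wlg; rewrite oppr_ge0.
have -> : cos x = 1 - 2 * sin (x / 2) ^+ 2.
  by rewrite [in LHS](splitr x) cosD -!expr2 cos2sin2; ring.
have [c cx] := @MVT_segment R sin cos 0 (x / 2) ltac:(lra) (fun z _ => is_derive_sin z)
  (continuous_subspaceT (@continuous_sin R)).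
rewrite sin0 !subr0 => ->; rewrite exprMn.
have c1 : cos c ^+ 2 <= 1 by have := cos2Dsin2 c; have := sqr_ge0 (sin c); lra.
have := sqr_ge0 (x / 2); rewrite expr_div_n; nra.
Qed.

(** With r = e^(2 v), the right-hand side is 4 (e^v - e^(-v))^2, and
    |v| <= |e^v - e^(-v)|. The bound is chosen for its expectation: r, 1 and 1 / r
    integrate against a gamma density to values of the gamma function. *)
Lemma ln_sqr_le (r : R) : 0 < r -> ln r ^+ 2 <= 4 * (r - 2 + r^-1).
Proof.
move=> r0; rewrite -[in leRHS](lnK r0) -expRN; set v := ln r / 2.
have lnE : ln r = v + v by rewrite /v; lra.
rewrite lnE (opprD v v) !expRD.
have ee : expR v * expR (- v) = 1 by rewrite -expRD subrr expR0.
have ep : 0 < expR v by exact: expR_gt0.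
have en : 0 < expR (- v) by exact: expR_gt0.
have h1 := expR_ge1Dx v; have h2 := expR_ge1Dx (- v).
have : v ^+ 2 <= (expR v - expR (- v)) ^+ 2.
  have [v0|/ltW v0] := leP 0 v.
    rewrite ler_sqr ?nnegrE//.
    - have : expR (- v) <= 1 by rewrite -expR0 ler_expR oppr_le0.
      lra.
    - have : expR (- v) <= 1 by rewrite -expR0 ler_expR oppr_le0.
      lra.
  have e1 : expR v <= 1 by rewrite -expR0 ler_expR.
  rewrite -(sqrrN v) -(sqrrN (_ - _)) opprB ler_sqr ?nnegrE; lra.
move=> vs; have -> : (v + v) ^+ 2 = 4 * v ^+ 2 by ring.
rewrite ler_pM2l//; apply: le_trans vs _.
move: ee; move: (expR v) (expR (- v)) => x y xy.
have -> : (x - y) ^+ 2 = x * x - 2 * (x * y) + y * y by ring.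
by rewrite xy mulr1.
Qed.

(** Take P = p + 1 and let G be the real gamma function. Bounding the cosine by
    1 - 2 t^2 (u / P - 2 + P / u) gives the lower bound
    (1 + 4 t^2) G(P) - (2 t^2 / P) G(P + 1) - 2 t^2 P G(P - 1), which equals
    G(p) (p - 2 t^2). *)
Lemma osc_gamma_gt0 t p : 0 < p -> 2 * t ^+ 2 < p ->
  0 < osc_gamma t (p + 1) (- (t * ln (p + 1))).
Proof.
move=> p0 tp; set P := p + 1; set k := t ^+ 2.
have P0 : 0 < P by rewrite /P; lra.
have k0 : 0 <= k := sqr_ge0 t.
pose G q : R := osc_gamma 0 q 0.
have GS q : 0 < q -> G (q + 1) = q * G q.
  by move=> q0; rewrite /G osc_gammaS// mul0r addr0.
have GE q : G q = Rintegral mu `]0, +oo[ (gamma_dens q).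
  by apply: eq_Rintegral => u _; rewrite mul0r addr0 cos0 mulr1.
have Gp := osc_gamma0_gt0 p0; rewrite -/(G p) in Gp.
have lb u : 0 < u -> gamma_dens P u * (1 + 4 * k) -
    (gamma_dens (P + 1) u * (2 * k / P) + gamma_dens p u * (2 * k * P)) <=
    gamma_dens P u * cos (t * ln u + - (t * ln P)).
  move=> u0; rewrite gamma_densS// /P gamma_densS// -/P.
  have -> : gamma_dens p u * u * (1 + 4 * k) -
     (gamma_dens p u * u * u * (2 * k / P) + gamma_dens p u * (2 * k * P)) =
     gamma_dens p u * u * (1 - 2 * k * (u / P - 2 + P / u)).
    by field; apply/andP; split; lra.
  rewrite ler_pM2l ?mulr_gt0 ?gamma_dens_gt0//.
  rewrite -mulrBr -ln_div ?posrE//.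
  apply: le_trans (cos_ge_1Bsqr _); rewrite exprMn -/k.
  have := @ln_sqr_le (u / P) (divr_gt0 u0 P0); rewrite invf_div.
  move: (ln _ ^+ 2) (_ - _ + _) => x y; nra.
have iP := integrable_gamma_dens P0.
have ip := integrable_gamma_dens p0.
have iP1 := integrable_gamma_dens (addr_gt0 P0 (@ltr01 R)).
have iZ (c : R) (h : R -> R) : mu.-integrable `]0, +oo[ (EFin \o h) ->
    mu.-integrable `]0, +oo[ (EFin \o (fun x => h x * c)).
  move=> ih; under [X in _ \o X]eq_fun do rewrite mulrC.
  exact: integrable_EFinZl.
have iD : mu.-integrable `]0, +oo[ (EFin \o (fun u =>
    gamma_dens (P + 1) u * (2 * k / P) + gamma_dens p u * (2 * k * P))).
  by apply: integrable_EFinD => //; exact: iZ.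
apply: (@lt_le_trans _ _ (G P * (1 + 4 * k) - (G (P + 1) * (2 * k / P) + G p * (2 * k * P)))).
  have GP : G P = p * G p := GS _ p0; have GP1 : G (P + 1) = P * G P := GS _ P0.
  rewrite GP1 GP.
  have -> : p * G p * (1 + 4 * k) - (P * (p * G p) * (2 * k / P) + G p * (2 * k * P)) =
    G p * (p - 2 * k).
    by rewrite /P; field; rewrite -/P gt_eqF.
  by rewrite mulr_gt0// subr_gt0.
rewrite !GE -!RintegralZr// -RintegralD//; [|exact: iZ..].
rewrite -RintegralB//; [|exact: iZ].
apply: le_Rintegral => //.
- by apply: integrable_EFinB => //; exact: iZ.
- exact: integrable_gamma_dens_cos.
- by move=> u /itv0yP; exact: lb.
Qed.

(** Otherwise [osc_gammaS] would make all the integrals vanish at p + n as well,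
    against [osc_gamma_gt0] for n large. *)
Lemma osc_gamma_neq0 t p : 0 < p -> exists phi, osc_gamma t p phi != 0.
Proof.
move=> p0; apply: contrapT => /forallNP all0.
have osc0 n phi : osc_gamma t (p + n%:R) phi = 0.
  elim: n phi => [phi|n IH phi].
    by rewrite addr0; apply/eqP; have /negP := all0 phi; rewrite negbK.
  by rewrite -natr1 addrA osc_gammaS ?IH ?mulr0 ?addr0// ltr_wpDr.
pose n := Num.truncn (2 * t ^+ 2).
have := @osc_gamma_gt0 t (p + n.+1%:R).
rewrite -addrA natr1 osc0 ltxx => h; suff : false by [].
apply: h; first by rewrite ltr_wpDr.
by rewrite (lt_le_trans (truncnS_gt _))// lerDr ltW.
Qed.

End oscillating_gamma.

(** * The complex gamma kernel and the zeros of Gamma *)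

Section complex_gamma_kernel.
Context {R : realType}.
Implicit Types (s : R[i]) (u : R).

Lemma cexpD (x y : R[i]) : cexp (x + y) = cexp x * cexp y.
Proof.
case: x => a b; case: y => c d; rewrite /cexp /= expRD cosD sinD.
by apply: eq_Re_Im; rewrite ?Re_mulc ?Im_mulc /= ; ring.
Qed.

Lemma cexp_real (x : R) : cexp x%:C = (expR x)%:C.
Proof. by rewrite /cexp /= cos0 sin0 mulr1. Qed.

Definition gamma_kernel s u : R[i] := cpow u (s - 1) * (expR (- u))%:C.

Lemma gamma_kernelE s u :
  gamma_kernel s u = cexp ((s - 1) * (ln u)%:C + (- u)%:C).
Proof. by rewrite cexpD cexp_real. Qed.

Lemma gamma_kernel_polar s u : gamma_kernel s u =
  (gamma_dens (complex.Re s) u)%:C *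
  (cos (complex.Im s * ln u) +i* sin (complex.Im s * ln u)).
Proof.
rewrite gamma_kernelE; case: s => p t /=.
rewrite (_ : _ * _ + _ = ((p - 1) * ln u - u) +i* (t * ln u)).
  by rewrite /cexp /gamma_dens.
by apply: eq_Re_Im => /=; ring.
Qed.

Lemma Re_gamma_kernel s u : complex.Re (gamma_kernel s u) =
  gamma_dens (complex.Re s) u * cos (complex.Im s * ln u + 0).
Proof. by rewrite gamma_kernel_polar Re_mulc /= mul0r subr0 addr0. Qed.

Lemma Im_gamma_kernel s u : complex.Im (gamma_kernel s u) =
  gamma_dens (complex.Re s) u * cos (complex.Im s * ln u + - (pi / 2)).
Proof. by rewrite gamma_kernel_polar Im_mulc /= mul0r addr0 cosBpihalf. Qed.

Lemma continuous_Re_gamma_kernel s u : 0 < u ->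
  {for u, continuous (fun u => complex.Re (gamma_kernel s u))}.
Proof.
move=> u0; rewrite (funext (Re_gamma_kernel s)).
exact: continuous_gamma_dens_cos.
Qed.

Lemma continuous_Im_gamma_kernel s u : 0 < u ->
  {for u, continuous (fun u => complex.Im (gamma_kernel s u))}.
Proof.
move=> u0; rewrite (funext (Im_gamma_kernel s)).
exact: continuous_gamma_dens_cos.
Qed.

Lemma cintegrable_gamma_kernel s : 0 < complex.Re s ->
  cintegrable `]0, +oo[ (gamma_kernel s).
Proof.
move=> s0; split.
- rewrite (funext (Re_gamma_kernel s)).
  exact: integrable_gamma_dens_cos.
- rewrite (funext (Im_gamma_kernel s)).
  exact: integrable_gamma_dens_cos.
Qed.

Lemma cintegrable_gamma_kernel_itv s u : 0 < complex.Re s ->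
  cintegrable `]0, u[ (gamma_kernel s).
Proof.
move=> /cintegrable_gamma_kernel[iRe iIm].
have sub : (`]0, u[ `<=` `]0, +oo[)%classic.
  by move=> x /=; rewrite !in_itv/= => /andP[-> _].
by split; [apply: integrableS iRe|apply: integrableS iIm].
Qed.

(** A zero of Gamma kills the integrals of phases 0 and - pi / 2, hence by the
    addition formula those of every phase. *)
Lemma Gamma_neq0 s : 0 < complex.Re s -> Gamma s != 0.
Proof.
move=> s0; apply/eqP => G0.
have [iRe iIm] := cintegrable_gamma_kernel s0.
have [phi /eqP] := osc_gamma_neq0 (complex.Im s) s0; apply.
have oRe : osc_gamma (complex.Im s) (complex.Re s) 0 = 0.
  transitivity (complex.Re (Gamma s)); last by rewrite G0.
  by apply: eq_Rintegral => u _; rewrite -Re_gamma_kernel.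
have oIm : osc_gamma (complex.Im s) (complex.Re s) (- (pi / 2)) = 0.
  transitivity (complex.Im (Gamma s)); last by rewrite G0.
  by apply: eq_Rintegral => u _; rewrite -Im_gamma_kernel.
have i0 := integrable_gamma_dens_cos (complex.Im s) 0 s0.
have i1 := integrable_gamma_dens_cos (complex.Im s) (- (pi / 2)) s0.
transitivity (cos phi * osc_gamma (complex.Im s) (complex.Re s) 0 -
              sin phi * osc_gamma (complex.Im s) (complex.Re s) (- (pi / 2))).
  rewrite /osc_gamma -!RintegralZl// -RintegralB//; [|exact: integrable_EFinZl..].
  apply: eq_Rintegral => u _.
  by rewrite cosBpihalf addr0 cosD; ring.
by rewrite oRe oIm !mulr0 subr0.
Qed.

Lemma normc_gamma_kernel s u :
  ComplexField.Normc.normc (gamma_kernel s u) = gamma_dens (complex.Re s) u.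
Proof.
rewrite gamma_kernel_polar ComplexField.Normc.normcM /= cos2Dsin2 sqrtr1 mulr1.
by rewrite expr0n addr0 sqrtr_sqr gtr0_norm// gamma_dens_gt0.
Qed.

Lemma normr_Re_le (z : R[i]) : `|complex.Re z| <= ComplexField.Normc.normc z.
Proof.
by case: z => x y /=; rewrite -sqrtr_sqr ler_wsqrtr// lerDl sqr_ge0.
Qed.

Lemma normr_Im_le (z : R[i]) : `|complex.Im z| <= ComplexField.Normc.normc z.
Proof.
by case: z => x y /=; rewrite -sqrtr_sqr ler_wsqrtr// lerDr sqr_ge0.
Qed.

End complex_gamma_kernel.

(** * The two substitutions *)

Section substitutions.
Context {R : realType}.
Local Notation mu := (@lebesgue_measure R).
Implicit Types (w theta : R).

Lemma pihalf_cos_sin theta : `]0, pi / 2[%classic theta ->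
  0 < cos theta /\ 0 < sin theta.
Proof.
rewrite /= in_itv/= => /andP[t0 tpi]; split.
  by apply: cos_gt0_pihalf; rewrite tpi andbT (lt_trans _ t0)// oppr_lt0 divr_gt0// pi_gt0.
by apply: sin_gt0_pihalf; rewrite t0.
Qed.

Lemma pihalf_tan theta : `]0, pi / 2[%classic theta -> 0 < tan theta.
Proof. by move=> /pihalf_cos_sin[c s]; rewrite divr_gt0. Qed.

Lemma pihalf_gt0 : 0 < pi / 2 :> R.
Proof. by rewrite divr_gt0// pi_gt0. Qed.

Definition tansq w theta : R := w * tan theta ^+ 2.
Definition dtansq w theta : R := 2 * w * tan theta * cos theta ^- 2.

Lemma is_derive_tansq w theta : `]0, pi / 2[%classic theta ->
  is_derive theta 1 (tansq w) (dtansq w theta).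
Proof.
move=> /pihalf_cos_sin[/lt0r_neq0 c0 _]; have dt := is_derive_tan c0.
have -> : tansq w = cst w * (tan ^+ 2) by apply/funext => x; rewrite /tansq !fctE.
apply: is_derive_eq.
by rewrite /GRing.scale /= mulr0 addr0 /dtansq expr1; ring.
Qed.

Lemma continuous_dtansq w theta : `]0, pi / 2[%classic theta ->
  {for theta, continuous (dtansq w)}.
Proof.
move=> /pihalf_cos_sin[/lt0r_neq0 c0 _].
apply: continuousM; last first.
  apply: continuousV; first by rewrite expf_eq0.
  by apply: continuousM; exact: continuous_cos.
by apply: continuousM; [exact: cst_continuous|exact: continuous_tan].
Qed.

Lemma dtansq_ge0 w theta : 0 <= w -> `]0, pi / 2[%classic theta ->
  0 <= dtansq w theta.
Proof.
move=> w0 /pihalf_tan/ltW t0.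
by rewrite /dtansq mulr_ge0 ?invr_ge0 ?sqr_ge0// mulr_ge0// mulr_ge0.
Qed.

Lemma ltr_tansq w : 0 < w ->
  {in `]0, pi / 2[%classic &, {homo tansq w : x y / x < y}}.
Proof.
move=> w0 x y; rewrite !inE => xp yp xy; rewrite ltr_pM2l//.
have tx := ltW (pihalf_tan xp); have ty := ltW (pihalf_tan yp).
rewrite ltr_sqr// ltr_tan//.
all: move: xp yp; rewrite /= !in_itv/= => /andP[x0 xpi] /andP[y0 ypi];
  apply/andP; split => //; have := pihalf_gt0; lra.
Qed.

Lemma image_tansq w : 0 < w -> tansq w @` `]0, pi / 2[ = `]0, +oo[%classic.
Proof.
move=> w0; apply/seteqP; split => [_ [x xp <-]|y].
  by rewrite /= in_itv/= andbT mulr_gt0// exprn_gt0// pihalf_tan.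
rewrite /= in_itv/= andbT => y0; exists (atan (Num.sqrt (y / w))).
  rewrite in_itv/= atan_ltpi2 andbT -[X in X < _](@atan0 R) lt_atan//.
  by rewrite sqrtr_gt0 divr_gt0.
rewrite /tansq atanK sqr_sqrtr; last by rewrite divr_ge0// ltW.
by field; lra.
Qed.

Lemma cintegral_tansq w (G : R -> R[i]) : 0 < w ->
  (forall u, 0 < u -> {for u, continuous (fun u => complex.Re (G u))}) ->
  (forall u, 0 < u -> {for u, continuous (fun u => complex.Im (G u))}) ->
  cintegral `]0, +oo[ G =
  cintegral `]0, pi / 2[ (fun theta => G (tansq w theta) * (dtansq w theta)%:C).
Proof.
move=> w0 cRe cIm; have im := image_tansq w0; rewrite -im.
apply: (cintegral_change_of_variables (exhausts_itvoo pihalf_gt0)).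
- exact: interval_open.
- exact: ltr_tansq.
- by rewrite im; exact: (@interval_is_interval R `]0, +oo[).
- exact: is_derive_tansq.
- exact: continuous_dtansq.
- by move=> x; apply: dtansq_ge0; exact: ltW.
- by rewrite im => y /itv0yP; exact: cRe.
- by rewrite im => y /itv0yP; exact: cIm.
Qed.

Lemma ge0_integral_tansq w (G : R -> R) : 0 < w ->
  (forall u, 0 < u -> {for u, continuous G}) ->
  (forall u, 0 < u -> 0 <= G u) ->
  (\int[mu]_(u in `]0%R, +oo[) (G u)%:E =
   \int[mu]_(theta in `]0%R, (pi / 2)%R[) (G (tansq w theta) * dtansq w theta)%:E)%E.
Proof.
move=> w0 cG G0; have im := image_tansq w0; rewrite -im.
apply: (ge0_integral_change_of_variables (exhausts_itvoo pihalf_gt0)).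
- exact: interval_open.
- exact: ltr_tansq.
- by rewrite im; exact: (@interval_is_interval R `]0, +oo[).
- exact: is_derive_tansq.
- exact: continuous_dtansq.
- by move=> x; apply: dtansq_ge0; exact: ltW.
- by rewrite im => y /itv0yP; exact: cG.
- by rewrite im => y /itv0yP; exact: G0.
Qed.

Lemma cintegral_scale (t c : R) (G : R -> R[i]) : 0 < t -> 0 < c ->
  (forall u, 0 < u -> {for u, continuous (fun u => complex.Re (G u))}) ->
  (forall u, 0 < u -> {for u, continuous (fun u => complex.Im (G u))}) ->
  cintegral `]0, t * c[ G = cintegral `]0, t[ (fun w => G (w * c) * c%:C).
Proof.
move=> t0 c0 cRe cIm.
have im : ( *%R^~ c) @` `]0, t[ = `]0, t * c[%classic.
  apply/seteqP; split => [_ [x xp <-]|y] /=.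
    by move: xp; rewrite /= !in_itv/= => /andP[? ?]; rewrite mulr_gt0//= ltr_pM2r.
  rewrite in_itv/= => /andP[y0 ytc]; exists (y / c).
    by rewrite in_itv/= divr_gt0//= ltr_pdivrMr.
  by rewrite divfK// gt_eqF.
rewrite -im.
apply: (@cintegral_change_of_variables _ _ _ _ _ (cst c) _ (exhausts_itvoo t0)).
- exact: interval_open.
- by move=> x y _ _ xy; rewrite ltr_pM2r.
- by rewrite im; exact: (@interval_is_interval R `]0, t * c[).
- move=> x _; have -> : *%R^~ c = (@idfun R) * cst c by [].
  by apply: is_derive_eq; rewrite /GRing.scale /= mulr0 add0r mulr1.
- by move=> x _; exact: cst_continuous.
- by move=> x _; exact: ltW.
- by rewrite im => y /=; rewrite in_itv/= => /andP[? _]; exact: cRe.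
- by rewrite im => y /=; rewrite in_itv/= => /andP[? _]; exact: cIm.
Qed.

End substitutions.

(** * The double integral *)

Section double_integral.
Context {R : realType}.
Local Notation mu := (@lebesgue_measure R).

(** The factor 1/2 is grouped with [gamma_kernel a w] and not cancelled against the
    2 in [dtansq], so that the kernel is literally a constant times
    G (tansq w theta) * dtansq w theta for fixed [w]. *)
Definition gamma_beta_kernel (a b : R[i]) (w theta : R) : R[i] :=
  gamma_kernel a w * (2^-1)%:C *
  (gamma_kernel b (tansq w theta) * (dtansq w theta)%:C).

(** All the factors are exponentials of linear combinations of ln w,
    ln (cos theta), ln (sin theta) and of - w sec^2 theta, the latter because
    w + w tan^2 theta = w sec^2 theta; the identity compares exponents. *)
Lemma gamma_beta_kernelE (a b : R[i]) (w theta : R) :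
  0 < w -> `]0, pi / 2[%classic theta ->
  gamma_beta_kernel a b w theta =
  cpow (cos theta) (2 * a - 1) * cpow (sin theta) (2 * b - 1) *
  gamma_kernel (a + b) (w * sec theta ^+ 2) * (sec theta ^+ 2)%:C.
Proof.
move=> w0 /pihalf_cos_sin[c0 s0].
have lnC (x y : R) : 0 < x -> ln x = y -> x%:C = cexp y%:C.
  by move=> x0 <-; rewrite cexp_real lnK.
set L := ln w; set c := ln (cos theta); set d := ln (sin theta).
have lntan : ln (tan theta) = d - c by rewrite ln_div.
have tan0 : 0 < tan theta by rewrite divr_gt0.
have lnsec : ln (sec theta ^+ 2) = - c - c.
  by rewrite expr2 lnM ?posrE ?invr_gt0// lnV.
have sec0 : 0 < sec theta ^+ 2 by rewrite exprn_gt0// invr_gt0.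
have lnts : ln (tansq w theta) = L + (d - c) + (d - c).
  by rewrite /tansq lnM ?posrE ?exprn_gt0// lnXn// lntan mulr2n addrA.
have lnws : ln (w * sec theta ^+ 2) = L - c - c.
  by rewrite lnM// lnsec addrA.
have E1 : (2^-1)%:C * (dtansq w theta)%:C = cexp (L + (d - c) + (- c - c))%:C.
  rewrite -rmorphM /dtansq (_ : 2^-1 * _ = w * tan theta * sec theta ^+ 2).
    apply: lnC; first exact: mulr_gt0 (mulr_gt0 w0 tan0) sec0.
    by rewrite lnM ?posrE ?(mulr_gt0 w0)// lnM// lntan lnsec.
  by rewrite /sec exprVn; field; lra.
have E2 : (sec theta ^+ 2)%:C = cexp (- c - c)%:C by exact: lnC.
have sq : tansq w theta = w * sec theta ^+ 2 - w.
  rewrite /tansq /sec exprVn cos2_tan2; first by ring.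
  exact: lt0r_neq0.
have -> : gamma_beta_kernel a b w theta = gamma_kernel a w *
    gamma_kernel b (tansq w theta) * ((2^-1)%:C * (dtansq w theta)%:C).
  by rewrite /gamma_beta_kernel; ring.
rewrite E1 E2 !gamma_kernelE /cpow -/c -/d -/L lnts lnws -!cexpD sq.
congr cexp; rewrite !(rmorphD, rmorphB, rmorphN)/=.
set w1 := w%:C; set w2 := (w * _)%:C; set l := L%:C; set c1 := c%:C; set d1 := d%:C.
ring.
Qed.

Lemma measurable_gamma_dens d (T : measurableType d) (D : set T) (p : R) (f : T -> R) :
  measurable_fun D f -> measurable_fun D (fun x => gamma_dens p (f x)).
Proof.
move=> mf; apply: (@measurableT_comp _ _ _ _ _ _ (@expR R) _ (fun x => (p - 1) * ln (f x) - f x)) => //.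
apply: measurable_funB => //.
by apply: measurable_funM => //; exact: (measurableT_comp (@measurable_ln R)).
Qed.

Lemma measurable_gamma_kernel d (T : measurableType d) (D : set T) (s : R[i]) (f : T -> R) :
  measurable_fun D f ->
  measurable_fun D (fun x => complex.Re (gamma_kernel s (f x))) /\
  measurable_fun D (fun x => complex.Im (gamma_kernel s (f x))).
Proof.
move=> mf.
have mcos t phi : measurable_fun D (fun x => cos (t * ln (f x) + phi)).
  apply: (@measurableT_comp _ _ _ _ _ _ (@cos R) _ (fun x => t * ln (f x) + phi)).
    exact: continuous_measurable_fun (@continuous_cos R).
  apply: measurable_funD => //.
  by apply: measurable_funM => //; exact: (measurableT_comp (@measurable_ln R)).
split.
- rewrite (_ : (fun x => _) = fun x => gamma_dens (complex.Re s) (f x) *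
      cos (complex.Im s * ln (f x) + 0)).
    by apply: measurable_funM => //; exact: measurable_gamma_dens.
  by apply/funext => x; rewrite Re_gamma_kernel.
- rewrite (_ : (fun x => _) = fun x => gamma_dens (complex.Re s) (f x) *
      cos (complex.Im s * ln (f x) + - (pi / 2))).
    by apply: measurable_funM => //; exact: measurable_gamma_dens.
  by apply/funext => x; rewrite Im_gamma_kernel.
Qed.

Lemma measurable_cmul d (T : measurableType d) (D : set T) (f g : T -> R[i]) :
  measurable_fun D (fun x => complex.Re (f x)) /\
  measurable_fun D (fun x => complex.Im (f x)) ->
  measurable_fun D (fun x => complex.Re (g x)) /\
  measurable_fun D (fun x => complex.Im (g x)) ->
  measurable_fun D (fun x => complex.Re (f x * g x)) /\
  measurable_fun D (fun x => complex.Im (f x * g x)).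
Proof.
move=> [fr fi] [gr gi]; split.
- rewrite (funext (fun x => Re_mulc (f x) (g x))).
  by apply: measurable_funB; apply: measurable_funM.
- rewrite (funext (fun x => Im_mulc (f x) (g x))).
  by apply: measurable_funD; apply: measurable_funM.
Qed.

Lemma measurable_gamma_beta_kernel (a b : R[i]) (t : R) :
  let D := (`]0, t[ `*` `]0, pi / 2[)%classic in
  measurable_fun D (fun z => complex.Re (gamma_beta_kernel a b z.1 z.2)) /\
  measurable_fun D (fun z => complex.Im (gamma_beta_kernel a b z.1 z.2)).
Proof.
move=> D.
have mD : measurable D by exact: measurableX.
have m1 : measurable_fun D (fst : R * R -> R).
  exact: (measurable_funS measurableT (@subsetT _ D) measurable_fst).
have m2 (f : R -> R) :
    (forall x, `]0, pi / 2[%classic x -> {for x, continuous f}) ->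
    measurable_fun D (fun z : R * R => f z.2).
  move=> cf.
  apply: (@measurable_comp _ _ _ _ _ _ `]0, pi / 2[%classic f D snd) => //.
  - by move=> _ [[x y] [/= _ Dy] <-].
  - exact: exhausts_measurable_fun (exhausts_itvoo pihalf_gt0) cf.
  - exact: (measurable_funS measurableT (@subsetT _ D) measurable_snd).
have mreal (f : R * R -> R) : measurable_fun D f ->
    measurable_fun D (fun z => complex.Re (f z)%:C) /\
    measurable_fun D (fun z => complex.Im (f z)%:C).
  by move=> mf; split => //=; exact: measurable_cst.
have mtan : measurable_fun D (fun z : R * R => tan z.2).
  apply: m2 => x /pihalf_cos_sin[/lt0r_neq0 c0 _]; exact: continuous_tan.
apply: measurable_cmul; apply: measurable_cmul.
- exact: measurable_gamma_kernel.
- by apply: mreal; exact: measurable_cst.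
- apply: measurable_gamma_kernel; apply: measurable_funM => //.
  exact: measurable_funX.
- apply: mreal; apply: measurable_funM.
    apply: measurable_funM => //.
    exact: measurable_funM.
  apply: (m2 (fun x => cos x ^- 2)) => x /pihalf_cos_sin[/lt0r_neq0 c0 _].
  apply: continuousV; first by rewrite expf_eq0.
  by apply: continuousM; exact: continuous_cos.
Qed.

(** The constant factor enters Euler's integral, whose integrand is known to be
    integrable, before the substitution. *)
Lemma cintegral_gamma_beta_kernel_theta (a b : R[i]) (w : R) :
  0 < complex.Re b -> 0 < w ->
  cintegral `]0, pi / 2[ (gamma_beta_kernel a b w) =
  gamma_kernel a w * (2^-1)%:C * Gamma b.
Proof.
move=> b0 w0; set k := gamma_kernel a w * _.
rewrite /Gamma -cintegralZl//; last exact: cintegrable_gamma_kernel.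
rewrite (cintegral_tansq w0) => [|u u0|u u0].
- by apply: eq_cintegral => theta _; rewrite /gamma_beta_kernel mulrA.
- have cr := @continuous_Re_gamma_kernel _ b _ u0.
  have ci := @continuous_Im_gamma_kernel _ b _ u0.
  rewrite (funext (fun u => Re_mulc k (gamma_kernel b u))).
  by apply: continuousB; apply: continuousM => //; exact: cst_continuous.
- have cr := @continuous_Re_gamma_kernel _ b _ u0.
  have ci := @continuous_Im_gamma_kernel _ b _ u0.
  rewrite (funext (fun u => Im_mulc k (gamma_kernel b u))).
  by apply: continuousD; apply: continuousM => //; exact: cst_continuous.
Qed.

Lemma cintegral_gamma_beta_kernel_w (a b : R[i]) (t theta : R) :
  0 < complex.Re (a + b) -> 0 < t -> `]0, pi / 2[%classic theta ->
  cintegral `]0, t[ (fun w => gamma_beta_kernel a b w theta) =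
  lower_gamma (a + b) (t * sec theta ^+ 2)
    * cpow (cos theta) (2 * a - 1) * cpow (sin theta) (2 * b - 1).
Proof.
move=> ab0 t0 tp; have [c0 s0] := pihalf_cos_sin tp.
have sec0 : 0 < sec theta ^+ 2 by rewrite exprn_gt0// invr_gt0.
rewrite -mulrA [RHS]mulrC; set k := _ * cpow (sin _) _.
rewrite /lower_gamma -cintegralZl//; last exact: cintegrable_gamma_kernel_itv.
rewrite (cintegral_scale t0 sec0) => [|u u0|u u0].
- apply: eq_cintegral => w; rewrite /= in_itv/= => /andP[w0 _].
  by rewrite gamma_beta_kernelE.
- have cr := @continuous_Re_gamma_kernel _ (a + b) _ u0.
  have ci := @continuous_Im_gamma_kernel _ (a + b) _ u0.
  rewrite (funext (fun u => Re_mulc k (gamma_kernel (a + b) u))).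
  by apply: continuousB; apply: continuousM => //; exact: cst_continuous.
- have cr := @continuous_Re_gamma_kernel _ (a + b) _ u0.
  have ci := @continuous_Im_gamma_kernel _ (a + b) _ u0.
  rewrite (funext (fun u => Im_mulc k (gamma_kernel (a + b) u))).
  by apply: continuousD; apply: continuousM => //; exact: cst_continuous.
Qed.

(** The modulus [g] of the kernel is the kernel of the real parts; integrating it
    in [theta] by the same substitution leaves a multiple of
    [gamma_dens p], which is integrable. *)
Lemma gamma_beta_kernel_Fubini (a b : R[i]) (t : R) :
  0 < complex.Re a -> 0 < complex.Re b ->
  cintegral `]0, t[ (fun w => cintegral `]0, pi / 2[ (gamma_beta_kernel a b w)) =
  cintegral `]0, pi / 2[ (fun theta =>
    cintegral `]0, t[ (fun w => gamma_beta_kernel a b w theta)).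
Proof.
move=> a0 b0; set p := complex.Re a; set q := complex.Re b.
pose g w theta := gamma_dens p w * 2^-1 *
  (gamma_dens q (tansq w theta) * dtansq w theta).
have normK w theta : 0 < w -> `]0, pi / 2[%classic theta ->
    ComplexField.Normc.normc (gamma_beta_kernel a b w theta) = g w theta.
  move=> w0 tp; rewrite /gamma_beta_kernel ComplexField.Normc.normcM.
  rewrite [X in X * _]ComplexField.Normc.normcM [X in _ * X]ComplexField.Normc.normcM.
  rewrite !normc_gamma_kernel /= !expr0n !addr0 !sqrtr_sqr.
  by rewrite (ger0_norm (dtansq_ge0 (ltW w0) tp)) ger0_norm.
have posw w : `]0, t[%classic w -> 0 < w by rewrite /= in_itv/= => /andP[].
have [mRe mIm] := measurable_gamma_beta_kernel a b t.
apply: (@cintegral_Fubini _ _ _ _ g) => //.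
- move=> w theta /posw w0 tp.
  by rewrite -(normK _ _ w0 tp); exact: normr_Re_le.
- move=> w theta /posw w0 tp.
  by rewrite -(normK _ _ w0 tp); exact: normr_Im_le.
pose M := Rintegral mu `]0, +oo[ (gamma_dens q).
have iq := integrable_gamma_dens b0.
have gE w : `]0, t[%classic w ->
    (\int[mu]_(theta in `]0%R, (pi / 2)%R[) (g w theta)%:E)%E =
    (gamma_dens p w * (2^-1 * M))%:E.
  rewrite /= in_itv/= => /andP[w0 _]; rewrite mulrA EFinM /M /Rintegral fineK; last first.
    exact: integrable_fin_num iq.
  rewrite -ge0_integralZl//; first last.
  - by rewrite lee_fin mulr_ge0 ?expR_ge0.
  - by move=> u _; rewrite lee_fin expR_ge0.
  - by case/integrableP : iq.
  under [RHS]eq_integral do rewrite -EFinM.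
  rewrite [RHS](@ge0_integral_tansq _ w (fun u => gamma_dens p w * 2^-1 * gamma_dens q u))//.
  - by apply: eq_integral => theta _; rewrite /g mulrA.
  - move=> u u0; apply: continuousM; first exact: cst_continuous.
    exact: continuous_gamma_dens.
  - by move=> u _; rewrite !mulr_ge0 ?expR_ge0.
have -> : (\int[mu]_(w in `]0%R, t[) \int[mu]_(theta in `]0%R, (pi / 2)%R[) (g w theta)%:E =
  \int[mu]_(w in `]0%R, t[) (gamma_dens p w * (2^-1 * M))%:E)%E.
  by apply: eq_integral => w; rewrite inE => /gE.
apply: (@integrable_lty _ _ _ mu) => //.
have sub : (`]0, t[ `<=` `]0, +oo[)%classic.
  by move=> x /=; rewrite !in_itv/= => /andP[-> _].
have ip : mu.-integrable `]0, t[ (EFin \o gamma_dens p).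
  by apply: integrableS (integrable_gamma_dens a0).
apply: (@eq_integrable _ _ _ mu _ _ (EFin \o (fun w => 2^-1 * M * gamma_dens p w))) => //.
  by move=> w _ /=; rewrite mulrC.
exact: integrable_EFinZl.
Qed.

End double_integral.

Theorem lemma2p4 (R : realType) (a b : R[i]) (t : R)
    (ha : 0 < complex.Re a) (hb : 0 < complex.Re b) (ht : 0 <= t) :
  lower_gamma a t =
  2 / Gamma b *
  cintegral `]0, pi / 2[ (fun theta : R =>
    lower_gamma (a + b) (t * sec theta ^+ 2)
    * cpow (cos theta) (2 * a - 1) * cpow (sin theta) (2 * b - 1)).
Proof.
have lower0 (s : R[i]) : lower_gamma s 0 = 0.
  rewrite /lower_gamma /cintegral.
  have -> : `]0, 0[%classic = set0 :> set R by rewrite set_itvoo0.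
  by rewrite !Rintegral_set0.
(* At t = 0 both sides vanish, whereas the substitutions need t > 0. *)
have [->|t_neq0] := eqVneq t 0.
  rewrite lower0 (_ : cintegral _ _ = 0) ?mulr0//.
  rewrite (@eq_cintegral _ _ _ (fun=> 0)); last first.
    by move=> theta _; rewrite mul0r lower0 !mul0r.
  by rewrite /cintegral /= /Rintegral integral0.
have t0 : 0 < t by rewrite lt_neqAle eq_sym t_neq0.
have ab0 : 0 < complex.Re (a + b).
  by case: a b ha hb => [p x] [q y] /= p0 q0; rewrite addr_gt0.
have G0 := Gamma_neq0 hb.
have -> : cintegral `]0, pi / 2[ (fun theta : R =>
    lower_gamma (a + b) (t * sec theta ^+ 2)
    * cpow (cos theta) (2 * a - 1) * cpow (sin theta) (2 * b - 1)) =
  lower_gamma a t * ((2^-1)%:C * Gamma b).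
  transitivity (cintegral `]0, t[ (fun w =>
      cintegral `]0, pi / 2[ (gamma_beta_kernel a b w))).
    rewrite gamma_beta_kernel_Fubini//; apply: eq_cintegral => theta tp.
    by rewrite cintegral_gamma_beta_kernel_w.
  rewrite /lower_gamma -cintegralZr//; last exact: cintegrable_gamma_kernel_itv.
  apply: eq_cintegral => w; rewrite /= in_itv/= => /andP[w0 _].
  by rewrite cintegral_gamma_beta_kernel_theta// mulrA.
have half : 2 * (2^-1)%:C = 1 :> R[i].
  by rewrite -(rmorph_nat (real_complex R)) -rmorphM divff ?pnatr_eq0.
by rewrite mulrCA mulrACA half mul1r mulVf// mulr1.
Qed.
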